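(* Let $n,t$ be integers with $1\le t\le n$. Then $f(n,t)\ge \frac{n^2(3t-n)}{2}$, and equality holds if $n$ is even and $t\ge n/2$.
   Context: A balanced tripartite graph with parts of size $n$ is a simple graph whose vertex set is the disjoint union of three sets $V_1,V_2,V_3$, each of size $n$, with no edge inside any $V_i$. For positive integers $n,t$, $f(n,t)$ denotes the minimum of $T(G)$ over all balanced tripartite graphs $G$ with parts of size $n$ and minimum degree $\delta(G)\ge n+t$, where $T(G)$ is the number of triangles in $G$. *)

(* Defs.v *)
From mathcomp Require Import all_boot all_order all_algebra.
From mathcomp Require Import classical_sets.
Set Implicit Arguments.
Unset Strict Implicit.
Unset Printing Implicit Defensive.

Record tripartite_graph (n : nat) := TripartiteGraph {
  vertex : finType;
  edge : rel vertex;
  part : 'I_3 -> {set vertex};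
  edge_sym : symmetric edge;
  edge_irr : irreflexive edge;
  card_part : forall i, #|part i| = n;
  part_disjoint : forall i j, i != j -> [disjoint part i & part j];
  part_cover : forall x, exists i, x \in part i;
  edge_part : forall i x y, x \in part i -> y \in part i -> ~~ edge x y
}.

Definition degree n (G : tripartite_graph n) (x : vertex G) : nat :=
  #|[set y | edge x y]|.

(* Every degree is at most the number of vertices, so for a nonempty graph the
   neutral element of this iterated minimum never affects its value. *)
Definition min_degree n (G : tripartite_graph n) : nat :=
  \big[minn/#|vertex G|]_(x : vertex G) degree x.

Definition is_triangle n (G : tripartite_graph n) (A : {set vertex G}) : bool :=
  (#|A| == 3) && [forall x in A, forall y in A, (x != y) ==> edge x y].

Definition triangles n (G : tripartite_graph n) : nat :=
  #|[set A : {set vertex G} | is_triangle A]|.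

Definition is_minimum (S : set nat) (m : nat) : Prop :=
  S m /\ forall k, S k -> m <= k.

Definition triangle_counts (n t : nat) : set nat := fun k =>
  exists G : tripartite_graph n, n + t <= min_degree G /\ triangles G = k.

(* The default value 0 is only taken when no admissible graph exists, which
   does not happen for t <= n: the complete tripartite graph has minimum degree
   2n. *)
Definition f (n t : nat) : nat := xget 0 (is_minimum (triangle_counts n t)).

(* Main.v *)
Require Import Defs.
From mathcomp Require Import all_boot all_order all_algebra.
From mathcomp Require Import boolp.
From mathcomp Require classical_sets.
From mathcomp Require Import zify lra.
Import Order.TTheory GRing.Theory Num.Theory.
Local Open Scope ring_scope.

(** Call a triple with one vertex in each part transversal, and let p, q, r be
    the 0/1 indicators of its three pairs being edges. Then
    p + q + r <= pqr + 2, with equality exactly when at least two of the pairs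
    are edges. Sum this over the n^3 transversal triples. Every triangle of a
    tripartite graph is transversal, so pqr sums to T(G); every edge lies in n
    transversal triples, so p + q + r sums to n e(G). Hence
    n e(G) <= T(G) + 2 n^3 ([degree_triangles], stated for the degree sum
    2 e(G)). Since 2 e(G) >= 3n(n + t), the bound
    T(G) >= n^2 (3t - n) / 2 follows ([triangles_lower_bound]).

    Equality holds as soon as every degree is n + t and no transversal triple
    misses two edges, that is, the non-neighbours of a vertex in the other two
    parts all lie in a single one of them ([triangles_tight]). For n even, cut
    each part V_i into halves A_i and B_i, start from the complete tripartite
    graph, and for each i modulo 3 delete an (n - t)-regular bipartite graph
    between B_i and A_{i+1}; this needs n - t <= n / 2, which is t >= n / 2.
    A vertex of B_i then only loses neighbours in V_{i+1}, and a vertex of A_i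
    only in V_{i-1} ([tight_graph]).

    As f is defined with a default value, f n t is known to be a minimum only
    once some graph satisfies the degree condition; the complete tripartite
    graph does. *)

Arguments part [n] t i%_R.

(** * Preliminaries *)

Lemma sum_ord3 (F : 'I_3 -> nat) :
  (\sum_i F i = F 0%R + F 1%R + F 2%:R)%N.
Proof.
rewrite !big_ord_recl big_ord0 addn0 addnA.
by congr (F _ + F _ + F _)%N; apply: val_inj.
Qed.

Lemma leq_bigminn (I : finType) (m d : nat) (F : I -> nat) :
  (d <= \big[minn/m]_i F i)%N <-> (d <= m)%N /\ (forall i, d <= F i)%N.
Proof.
split=> [|[dm dF]].
  have -> : (forall i, d <= F i)%N <-> (forall i, i \in index_enum I -> d <= F i)%N.
    by split=> H i => [_|]; apply: H; rewrite ?mem_index_enum.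
  elim: (index_enum I) => [|i s IH]; first by rewrite big_nil.
  rewrite big_cons leq_min => /andP[di /IH[dm ds]]; split=> // j.
  by rewrite inE => /predU1P[->|/ds].
by elim/big_ind: _ => // x y dx dy; rewrite leq_min dx.
Qed.

Lemma is_minimum_ex (S : classical_sets.set nat) k : S k -> exists m, is_minimum S m.
Proof.
move=> Sk; have exS : exists m, `[< S m >] by exists k; apply/asboolP.
by case: (ex_minnP exS) => m /asboolP Sm minS; exists m; split=> // j /asboolP/minS.
Qed.

Lemma f_is_minimum {n t : nat} (G : tripartite_graph n) :
  (n + t <= min_degree G)%N -> is_minimum (triangle_counts n t) (f n t).
Proof.
move=> dG; apply: classical_sets.xgetPex.
by apply: (@is_minimum_ex _ (triangles G)); exists G.
Qed.

(** * Counting over transversal triples *)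

Section Counting.
Context {n : nat} (G : tripartite_graph n).
Implicit Types (x y z : vertex G) (i j : 'I_3).

(** The part containing a vertex, as a function, so that sums over vertices can
    be split along its fibres. *)
Definition color x : 'I_3 := odflt 0 [pick i | x \in part G i].

Lemma in_part x i : (x \in part G i) = (color x == i).
Proof.
rewrite /color; case: pickP => [j xj|no] /=; last first.
  by have [j xj] := part_cover (t:=G) x; rewrite no in xj.
apply/idP/eqP => [xi|<- //]; apply/eqP; apply: contraT.
rewrite eq_sym => /(@part_disjoint n G).
by move=> /disjointFr/(_ xi); rewrite xj.
Qed.

Lemma edge_neq x y : edge x y -> (x == y) = false.
Proof. by case: eqP => // ->; rewrite edge_irr. Qed.

Lemma sum_part (F : vertex G -> nat) :
  (\sum_x F x = \sum_i \sum_(x in part G i) F x)%N.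
Proof.
rewrite (partition_big color predT) //=; apply: eq_bigr => i _.
by apply: eq_bigl => x; rewrite in_part.
Qed.

Definition edges_between i j : nat :=
  (\sum_(x in part G i) \sum_(y in part G j) edge x y)%N.
Arguments edges_between (i j)%_R.

Lemma edges_betweenC i j : edges_between i j = edges_between j i.
Proof.
rewrite /edges_between exchange_big /=.
by do 2![apply: eq_bigr => ? _]; rewrite edge_sym.
Qed.

Lemma edges_betweenii i : edges_between i i = 0%N.
Proof.
by apply: big1 => x xi; apply: big1 => y yi; rewrite (negbTE (edge_part xi yi)).
Qed.

Lemma sum_degree :
  (\sum_(x : vertex G) degree x =
   2 * (edges_between 0 1 + edges_between 1 2%:R + edges_between 0 2%:R))%N.
Proof.
transitivity (\sum_i \sum_j edges_between i j)%N.
  rewrite sum_part; apply: eq_bigr => i _; rewrite exchange_big /=.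
  apply: eq_bigr => x _.
  by rewrite /degree -sum1dep_card big_mkcond -sum_part; apply: eq_bigr => y _; case: edge.
rewrite sum_ord3 !sum_ord3 !edges_betweenii.
rewrite (edges_betweenC 1 0) (edges_betweenC 2%:R 0) (edges_betweenC 2%:R 1).
lia.
Qed.

Definition transversal_sum (F : vertex G -> vertex G -> vertex G -> nat) : nat :=
  (\sum_(x in part G 0) \sum_(y in part G 1) \sum_(z in part G 2%:R) F x y z)%N.

(** A part is independent, so it holds at most one vertex of the clique; three
    parts must account for three vertices, so each holds exactly one. *)
Lemma clique_meets_part {A : {set vertex G}} : is_triangle A ->
  forall i, exists2 x, x \in A & x \in part G i.
Proof.
case/andP=> /eqP A3 /forall_inP cl.
have le1 i : (#|A :&: part G i| <= 1)%N.
  apply/card_le1_eqP => x y; rewrite !inE => /andP[xA xi] /andP[yA yi].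
  have /forall_inP/(_ y yA)/implyP/contraNT := cl x xA.
  by move=> /(_ (edge_part xi yi))/eqP.
have sum3 : (\sum_i #|A :&: part G i| = 3)%N.
  transitivity #|A| => //.
  rewrite -[RHS]sum1_card [RHS]big_mkcond sum_part; apply: eq_bigr => i _.
  by rewrite -big_mkcondr -sum1_card; apply: eq_bigl => x; rewrite inE andbC.
move=> i; suff /card_gt0P[x] : (0 < #|A :&: part G i|)%N.
  by rewrite inE => /andP[]; exists x.
move: sum3; rewrite (bigD1 i) //=; set S := (\sum_(j | j != i) _)%N => sum3.
have S2 : (S <= 2)%N.
  apply: (@leq_trans (\sum_(j < 3 | j != i) 1)); first exact: leq_sum.
  by rewrite sum1dep_card cardsE cardC1 card_ord.
by rewrite -(ltn_add2r S) sum3.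
Qed.

(** The vertices of a triangle, ordered by the part they belong to, give a
    bijection between triangles, as sets, and adjacent transversal triples. *)
Lemma triangles_transversal :
  triangles G = transversal_sum (fun x y z => [&& edge x y, edge y z & edge x z]).
Proof.
pose S := [set u : vertex G * (vertex G * vertex G) |
  [&& u.1 \in part G 0, u.2.1 \in part G 1 & u.2.2 \in part G 2%:R] &&
  [&& edge u.1 u.2.1, edge u.2.1 u.2.2 & edge u.1 u.2.2]].
pose g (u : vertex G * (vertex G * vertex G)) := [set u.1; u.2.1; u.2.2].
transitivity #|S|; last first.
  rewrite /transversal_sum; under [RHS]eq_bigr => x _ do rewrite pair_big /=.
  rewrite pair_big /= -sum1_card big_mkcond [RHS]big_mkcond.
  by apply: eq_bigr => u _; rewrite inE; do 3![case: (_ \in _) => //]; case: ifP.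
(* A vertex of g u is identified by its color, which makes g injective. *)
have gS u : u \in S -> forall x, x \in g u ->
    x = if color x == 0 then u.1 else if color x == 1 then u.2.1 else u.2.2.
  rewrite inE !in_part => /andP[/and3P[/eqP c0 /eqP c1 /eqP c2] _] x.
  by rewrite !inE => /orP[/orP[]|] /eqP->; rewrite ?c0 ?c1 ?c2.
rewrite /triangles -(@card_in_imset _ _ g S); last first.
  move=> u v uS vS guv.
  move: (uS); rewrite inE !in_part => /andP[/and3P[/eqP c0 /eqP c1 /eqP c2] _].
  have gv x : x \in g u -> x = if color x == 0 then v.1
      else if color x == 1 then v.2.1 else v.2.2.
    by rewrite guv; apply: gS.
  case: u v uS vS guv c0 c1 c2 gv => [x [y z]] [x' [y' z']] /= _ _ _ c0 c1 c2 gv.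
  have := gv x; have := gv y; have := gv z.
  rewrite c0 c1 c2 !inE !eqxx /= !orbT /=.
  by do 3![move=> /(_ isT) ->].
congr #|pred_of_set _|; apply/setP => A; apply/idP/imsetP => [|[u uS ->]].
  rewrite inE => tA; have meet := clique_meets_part tA.
  case/andP: (tA) => /eqP A3 /forall_inP cl.
  have [[[x xA x0] [y yA y1]] [z zA z2]] := (meet 0, meet 1, meet 2%:R).
  have ad a b i j : a \in A -> b \in A -> a \in part G i -> b \in part G j ->
      i != j -> edge a b.
    rewrite !in_part => aA bA /eqP<- /eqP<- ij.
    have /forall_inP/(_ b bA)/implyP := cl a aA; apply.
    by apply: contraNneq ij => ->.
  have exy := ad _ _ _ _ xA yA x0 y1 isT.
  have eyz := ad _ _ _ _ yA zA y1 z2 isT.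
  have exz := ad _ _ _ _ xA zA x0 z2 isT.
  exists (x, (y, z)); first by rewrite inE /= x0 y1 z2 exy eyz exz.
  apply/esym/eqP; rewrite eqEcard A3 /g /=; apply/andP; split.
    by apply/subsetP => w; rewrite !inE => /orP[/orP[]|] /eqP->.
  by rewrite setUC cardsU1 cards2 !inE ![z == _]eq_sym !edge_neq.
move: uS; rewrite !inE => /andP[_ /and3P[exy eyz exz]].
apply/andP; split.
  by rewrite /g setUC cardsU1 cards2 !inE ![u.2.2 == _]eq_sym !edge_neq.
apply/forall_inP => a; rewrite !inE => aA; apply/forall_inP => b; rewrite !inE => bA.
apply/implyP; case/orP: aA => [/orP[]|] /eqP->; case/orP: bA => [/orP[]|] /eqP->;
  by rewrite ?eqxx // edge_sym.
Qed.

(** Each edge between two parts is extended to a transversal triple by any of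
    the n vertices of the third part. *)
Lemma transversal_sum_edges :
  transversal_sum (fun x y z => edge x y + edge y z + edge x z)%N =
  (n * (edges_between 0 1 + edges_between 1 2%:R + edges_between 0 2%:R))%N.
Proof.
rewrite /transversal_sum !mulnDr.
under eq_bigr => x _.
  under eq_bigr => y _ do rewrite !big_split /= sum_nat_const card_part.
  rewrite !big_split /= -big_distrr /=.
  rewrite [X in (_ + X)%N]sum_nat_const card_part; over.
rewrite !big_split /= -!big_distrr /=; congr (_ + _ + _)%N.
by rewrite sum_nat_const card_part.
Qed.

(** The sum over all transversal triples of p + q + r <= pqr + 2, doubled so
    that the number of edges appears as a degree sum. *)
Lemma degree_triangles :
  (n * (\sum_(x : vertex G) degree x) <= 2 * triangles G + 4 * n ^ 3
   ?= iff [forall (x | x \in part G 0), forall (y | y \in part G 1),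
           forall (z | z \in part G 2%:R), 1 < edge x y + edge y z + edge x z])%N.
Proof.
have -> : (2 * triangles G + 4 * n ^ 3 = 2 * transversal_sum
    (fun x y z => [&& edge x y, edge y z & edge x z] + 2))%N.
  rewrite triangles_transversal /transversal_sum.
  under [in RHS]eq_bigr => x _.
    under eq_bigr => y _ do rewrite big_split /= sum_nat_const card_part.
    rewrite big_split /= sum_nat_const card_part; over.
  rewrite big_split /= sum_nat_const card_part; lia.
rewrite sum_degree mulnCA -transversal_sum_edges.
rewrite (@mono_leqif (muln 2)); last by move=> ? ?; rewrite leq_pmul2l.
apply: leqif_sum => x _; apply: leqif_sum => y _; apply: leqif_sum => z _.
by do 3![case: edge].
Qed.

Lemma triangles_lower_bound t : (n + t <= min_degree G)%N ->
  (3 * t * n ^ 2 <= 2 * triangles G + n ^ 3)%N.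
Proof.
case/leq_bigminn=> _ dG.
have dsum : (3 * n * (n + t) <= \sum_(x : vertex G) degree x)%N.
  rewrite sum_part sum_ord3.
  have part_sum i : (n * (n + t) <= \sum_(x in part G i) degree x)%N.
    by rewrite -{1}(card_part G i) -sum_nat_const; apply: leq_sum.
  have := leq_add (leq_add (part_sum 0) (part_sum 1)) (part_sum 2%:R); lia.
have := leq_trans (leq_mul (leqnn n) dsum) (leq_of_leqif degree_triangles).
lia.
Qed.

Lemma triangles_tight t : (forall x, degree x = n + t)%N ->
    (forall x y z, x \in part G 0 -> y \in part G 1 -> z \in part G 2%:R ->
       1 < edge x y + edge y z + edge x z)%N ->
  (2 * triangles G + n ^ 3 = 3 * t * n ^ 2)%N.
Proof.
move=> dG two.
have dsum : (\sum_(x : vertex G) degree x = 3 * n * (n + t))%N.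
  rewrite (eq_bigr (fun=> n + t)%N) // sum_part sum_ord3 !sum_nat_const !card_part.
  lia.
have := eqTleqif degree_triangles; rewrite dsum => tight.
suff /tight : [forall (x | x \in part G 0), forall (y | y \in part G 1),
    forall (z | z \in part G 2%:R), 1 < edge x y + edge y z + edge x z]%N by lia.
apply/forall_inP => x x0; apply/forall_inP => y y1; apply/forall_inP => z z2.
exact: two.
Qed.
End Counting.

(** * Deleting edges from the complete tripartite graph *)

Section Construction.
Context {n : nat} {T : finType} (cardT : #|T| = n) (miss : rel ('I_3 * T))
  (miss_sym : symmetric miss).

(** Pairs inside a part are non-edges whatever [miss] says of them; [miss] only
    prescribes which cross pairs are deleted. *)
Definition co_edge : rel ('I_3 * T) := fun x y => (x.1 != y.1) && ~~ miss x y.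
Definition fiber (i : 'I_3) : {set 'I_3 * T} := [set x | x.1 == i].

Fact co_edge_sym : symmetric co_edge.
Proof. by move=> x y; rewrite /co_edge eq_sym miss_sym. Qed.

Fact co_edge_irr : irreflexive co_edge.
Proof. by move=> x; rewrite /co_edge eqxx. Qed.

Fact card_fiber i : #|fiber i| = n.
Proof.
have -> : fiber i = setX [set i] [set: T].
  by apply/setP => -[j a]; rewrite !inE andbT.
by rewrite cardsX cards1 cardsT mul1n.
Qed.

Fact fiber_disjoint i j : i != j -> [disjoint fiber i & fiber j].
Proof.
move=> ij; apply/pred0P => x /=; rewrite !inE.
by apply/andP => -[/eqP-> /eqP ij']; rewrite ij' eqxx in ij.
Qed.

Fact fiber_cover x : exists i, x \in fiber i.
Proof. by exists x.1; rewrite inE. Qed.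

Fact fiber_independent i x y : x \in fiber i -> y \in fiber i -> ~~ co_edge x y.
Proof. by rewrite !inE /co_edge => /eqP-> /eqP->; rewrite eqxx. Qed.

Definition cograph : tripartite_graph n :=
  TripartiteGraph co_edge_sym co_edge_irr card_fiber fiber_disjoint
    fiber_cover fiber_independent.

Lemma degree_cograph x : (forall y, miss x y -> x.1 != y.1) ->
  @degree n cograph x = (2 * n - #|[set y | miss x y]|)%N.
Proof.
move=> miss_neq; rewrite /degree /=.
have -> : [set y | co_edge x y] = ~: fiber x.1 :\: [set y | miss x y].
  by apply/setP => y; rewrite !inE /co_edge andbC eq_sym.
rewrite cardsD (setIidPr _); last first.
  by apply/subsetP => y; rewrite !inE eq_sym; apply: miss_neq.
congr (_ - _)%N; rewrite cardsCs setCK card_fiber card_prod card_ord cardT; lia.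
Qed.

Lemma min_degree_cograph d : (d <= 2 * n)%N ->
  (forall x, d <= @degree n cograph x)%N -> (d <= min_degree cograph)%N.
Proof.
move=> dn dG; apply/leq_bigminn; split=> //=.
by rewrite card_prod card_ord cardT; lia.
Qed.
End Construction.

Lemma complete_graph_admissible n t : (t <= n)%N ->
  exists G : tripartite_graph n, (n + t <= min_degree G)%N.
Proof.
move=> tn; have sym0 : symmetric (fun _ _ : 'I_3 * 'I_n => false) by [].
exists (cograph (card_ord n) _ sym0); apply: min_degree_cograph; first lia.
move=> x; rewrite degree_cograph // (_ : finset _ = set0) ?cards0; first lia.
by apply/setP => y; rewrite !inE.
Qed.

(** * The extremal graph and the theorem *)

Section Circulant.
Context (h s : nat).
Let T : finType := (bool * 'I_h.+1)%type.

(** A vertex is a part, a bit choosing its half (true for B, false for A) and a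
    position in the half. Deleted pairs join B_i to A_{i+1}, and the regular
    bipartite graph between these halves relates positions u and v when u + v
    reduces below s modulo the size of a half: this is s-regular when s is at
    most that size, and symmetric in u and v. *)
Definition circ_miss : rel ('I_3 * T) := fun x y =>
  [&& x.2.1 != y.2.1, if x.2.1 then y.1 == x.1 + 1 else x.1 == y.1 + 1
    & ((x.2.2 + y.2.2)%R < s)%N].

Lemma circ_miss_sym : symmetric circ_miss.
Proof.
move=> [i [b u]] [j [c v]]; rewrite /circ_miss /= [(u + v)%N]addnC.
by case: b; case: c.
Qed.

Lemma ord3_neq_succ (i : 'I_3) : i != i + 1.
Proof. by rewrite -subr_eq0 opprD addNKr. Qed.

Lemma circ_miss_neq x y : circ_miss x y -> x.1 != y.1.
Proof.
case/and3P => _ + _; case: ifP => _ /eqP ->; first exact: ord3_neq_succ.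
by rewrite eq_sym ord3_neq_succ.
Qed.

Lemma card_circ_miss x : (s <= h.+1)%N -> #|[set y | circ_miss x y]| = s.
Proof.
case: x => i [b u] sh.
(* The deleted partners of x all lie in one half of one part, and their
   positions are the w - u with w < s. *)
pose emb (w : 'I_h.+1) : 'I_3 * T := (if b then i + 1 else i - 1, (~~ b, w - u)).
have -> : [set y | circ_miss (i, (b, u)) y] = emb @: [set w : 'I_h.+1 | (w < s)%N].
  apply/setP => -[j [c v]]; rewrite !inE /circ_miss.
  apply/idP/imsetP => [/and3P[/= bc ij uv]|[w]].
    exists (u + v); first by rewrite inE.
    rewrite /emb addrAC subrr add0r.
    by move: bc ij {emb}; case: b; case: c => // _ /eqP->; rewrite ?addrK.
  rewrite inE => ws [-> -> ->]; apply/and3P; split.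
  - by case: (b).
  - by case: (b); rewrite /= ?subrK.
  - by rewrite (_ : _ + _ = w) //= addrC subrK.
rewrite card_imset; last by move=> v w /(congr1 (fun y => y.2.2)) /addIr.
by rewrite -sum1dep_card big_ord_narrow // sum1_card card_ord.
Qed.

(** Two deleted pairs of a transversal triple would share a vertex, which would
    have to be in half B for the pair going to the next part and in half A for
    the pair going to the previous one. *)
Lemma circ_miss_sparse (x y z : 'I_3 * T) : x.1 = 0 -> y.1 = 1 -> z.1 = 2%:R ->
  (circ_miss x y + circ_miss y z + circ_miss x z <= 1)%N.
Proof.
case: x y z => [i [b u]] [j [c v]] [k [d w]] /= -> -> ->; rewrite /circ_miss /=.
move: (_ < s)%N (_ < s)%N (_ < s)%N => p q r.
by move: b c d p q r; do 6![case].
Qed.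
End Circulant.

Lemma tight_graph n t : ~~ odd n -> (0 < n)%N -> (n <= 2 * t)%N -> (t <= n)%N ->
  exists G : tripartite_graph n, (n + t <= min_degree G)%N /\
    (2 * triangles G + n ^ 3 = 3 * t * n ^ 2)%N.
Proof.
move=> /even_halfK; case: n./2 => [<- //|h] nE _ nt tn; pose s := (n - t)%N.
have cardT : #|{: bool * 'I_h.+1}| = n.
  by rewrite card_prod card_bool card_ord mul2n.
pose G := cograph cardT _ (circ_miss_sym h s).
have degG (x : vertex G) : degree x = (n + t)%N.
  rewrite degree_cograph ?card_circ_miss; [rewrite /s; lia|rewrite /s; lia|].
  by move=> y; apply: circ_miss_neq.
exists G; split; first by apply: min_degree_cograph => [|x]; rewrite ?degG; lia.
apply: triangles_tight => // x y z; rewrite !inE => /eqP x0 /eqP y1 /eqP z2.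
have := circ_miss_sparse h s x y z x0 y1 z2.
rewrite /= /co_edge x0 y1 z2 /=.
by do 3![case: circ_miss].
Qed.

Theorem proposition1p6 (n t : nat) (t_ge1 : (1 <= t)%N) (t_le_n : (t <= n)%N) :
  (n%:R ^+ 2 * (3 * t%:R - n%:R) / 2 <= (f n t)%:R :> rat)
  /\ (~~ odd n -> n%:R / 2 <= t%:R :> rat ->
      (f n t)%:R = n%:R ^+ 2 * (3 * t%:R - n%:R) / 2 :> rat).
Proof.
have [G0 dG0] := complete_graph_admissible _ _ t_le_n.
have [[G [dG <-]] minG] := f_is_minimum _ dG0.
have low : n%:R ^+ 2 * (3 * t%:R - n%:R) / 2 <= (triangles G)%:R :> rat.
  have := triangles_lower_bound _ _ dG.
  rewrite -(ler_nat rat) !(natrM, natrD, natrX); lra.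
split=> // even_n n_le_2t; apply: le_anti; rewrite low andbT.
have nt : (n <= 2 * t)%N by rewrite -(ler_nat rat) natrM; lra.
have [H [dH TH]] := tight_graph _ _ even_n (leq_trans t_ge1 t_le_n) nt t_le_n.
have : (triangles G <= triangles H)%N by apply: minG; exists H.
move: (congr1 (fun k => k%:R : rat) TH); rewrite -(ler_nat rat).
rewrite !(natrM, natrD, natrX); lra.
Qed.
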